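(* Let $(A,[\ ,\ ]_A,\cdot_A,\delta_r,\Delta_r)$ be a factorizable Poisson bialgebra with $I_r=r_+-r_-$, and let $\lambda\in\mathbb K$, $\lambda\neq0$. Define a linear map $P:A\to A$ and a bilinear form $\mathfrak B$ on $A$ by $$P=-\lambda\, r_+\circ I_r^{-1},\qquad \mathfrak B(a,b)=-\lambda\langle I_r^{-1}(a),b\rangle,\quad a,b\in A.$$ Then $((A,[\ ,\ ]_A,\cdot_A),\mathfrak B,P)$ is a quadratic Rota-Baxter Poisson algebra of weight $\lambda$.
   Context: All vector spaces are finite-dimensional over a field $\mathbb K$ of characteristic $0$; algebras need not be unital. A Poisson algebra $(A,[\ ,\ ]_A,\cdot_A)$ is a Lie algebra and a commutative associative algebra on the same space with $[a,b\cdot_A c]_A=[a,b]_A\cdot_A c+b\cdot_A[a,c]_A$. Write $\mathrm{ad}(a)b=[a,b]_A$, $L(a)b=a\cdot_A b$. For $r=\sum_i a_i\otimes b_i\in A\otimes A$ put $\delta_r(a)=(\mathrm{id}\otimes\mathrm{ad}(a)+\mathrm{ad}(a)\otimes\mathrm{id})(r)$, $\Delta_r(a)=(\mathrm{id}\otimes L(a)-L(a)\otimes\mathrm{id})(r)$. $r$ is a solution of the Poisson Yang-Baxter equation if $\mathbf C(r)=\mathbf A(r)=0$, where $\mathbf C(r)=\sum_{i,j}([a_i,a_j]_A\otimes b_i\otimes b_j+a_i\otimes a_j\otimes[b_i,b_j]_A+a_i\otimes[b_i,a_j]_A\otimes b_j)$, $\mathbf A(r)=\sum_{i,j}(a_i\cdot_A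 a_j\otimes b_i\otimes b_j+a_i\otimes a_j\otimes b_i\cdot_A b_j-a_i\otimes a_j\cdot_A b_i\otimes b_j)$. $s\in A\otimes A$ is $(\mathrm{ad},L)$-invariant if $(\mathrm{ad}(a)\otimes\mathrm{id}+\mathrm{id}\otimes\mathrm{ad}(a))(s)=0=(L(a)\otimes\mathrm{id}-\mathrm{id}\otimes L(a))(s)$ for all $a\in A$. If $r$ solves the Poisson Yang-Baxter equation and its symmetric part $\frac12(r+\tau(r))$ ($\tau$ the flip) is $(\mathrm{ad},L)$-invariant, then $(A,[\ ,\ ]_A,\cdot_A,\delta_r,\Delta_r)$ is a Poisson bialgebra (known), called quasi-triangular. Here $r_\pm:A^*\to A$ are defined by $\langle r_+(x^* ),y^*\rangle=-\langle x^*,r_-(y^* )\rangle=\langle r,x^*\otimes y^*\rangle$. The quasi-triangular Poisson bialgebra is factorizable if the symmetric part of $r$ is nondegenerate, i.e. $I_r=r_+-r_-:A^*\to A$ is a linear isomorphism. Quadratic Rota-Baxter Poisson algebra of weight $\lambda$: a Poisson algebra with a nondegenerate symmetric bilinear form $\mathfrak B$ that is invariant ($\mathfrak B([a,b]_A,c)=\mathfrak B(a,[b,c]_A)$, $\mathfrak B(a\cdot_A b,c)=\mathfrak B(a,b\cdot_A c)$) and a linear map $P:A\to A$ that is a Rota-Baxter operator of weight $\lambda$: $[P(a),P(b)]_A=P([P(a),b]_A+[a,P(b)]_A+\lambda[a,b]_A)$, $P(a)\cdot_A P(b)=P(P(a)\cdot_A b+a\cdot_A P(b)+\lambda a\cdot_A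 b)$, such that $\mathfrak B(a,P(b))+\mathfrak B(P(a),b)+\lambda\mathfrak B(a,b)=0$ for all $a,b\in A$. *)

(* Defs.v *)
From HB Require Import structures.
From mathcomp Require Import all_boot all_order all_algebra.

Set Implicit Arguments.
Unset Strict Implicit.
Unset Printing Implicit Defensive.

Import GRing.Theory.
Local Open Scope ring_scope.

Section Tensor.
Variable K : fieldType.
Implicit Types U V W : vectType K.

(* MathComp has no tensor product of vector spaces.  We take for U (x) V the
   space of coordinate matrices with respect to the bases of the library; the
   lemmas tens_bilinear, tens_span and tens_lift_tens below are its universal
   property, so that nothing depends on these bases. *)
Definition tensor U V : vectType K := 'M[K]_(\dim {:U}, \dim {:V}).

Definition tens U V (u : U) (v : V) : tensor U V :=
  \matrix_(i, j) (coord (vbasis {:U}) i u * coord (vbasis {:V}) j v).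

(* For bilinear f, the linear map on U (x) V sending u (x) v to f u v. *)
Definition tens_lift U V W (f : U -> V -> W) (t : tensor U V) : W :=
  \sum_i \sum_j
    (t : 'M_(_, _)) i j *: f (vbasis {:U})`_i (vbasis {:V})`_j.

End Tensor.

Notation "u *t v" := (tens u v) (at level 40, left associativity) : ring_scope.

Section TensorTheory.
Variable K : fieldType.
Implicit Types U V W : vectType K.

Lemma tens_bilinear U V : bilinear_for *:%R *:%R (@tens K U V).
Proof.
split=> [v a x y | u a x y]; apply/matrixP=> i j; rewrite !mxE linearP.
- by rewrite mulrDl mulrA.
- by rewrite mulrDr mulrCA.
Qed.

Lemma tens_lift_linear U V W (f : U -> V -> W) : linear (tens_lift f).
Proof.
move=> a s t; rewrite /tens_lift scaler_sumr -big_split /=; apply: eq_bigr => i _.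
rewrite scaler_sumr -big_split /=; apply: eq_bigr => j _.
by rewrite !mxE scalerDl scalerA.
Qed.

HB.instance Definition _ U V W (f : U -> V -> W) :=
  GRing.isLinear.Build K (tensor U V) W *:%R (tens_lift f) (tens_lift_linear f).

Lemma bilinear_suml U V W (f : U -> V -> W) (I : Type) (s : seq I)
    (a : I -> K) (u : I -> U) v : bilinear_for *:%R *:%R f ->
  f (\sum_(i <- s) a i *: u i) v = \sum_(i <- s) a i *: f (u i) v.
Proof.
case=> fl _; elim: s => [|i s IHs]; last by rewrite !big_cons fl IHs.
rewrite !big_nil; have := fl v (-1) 0 0.
by rewrite /= scaler0 addr0 scaleN1r addNr.
Qed.

Lemma bilinear_sumr U V W (f : U -> V -> W) (I : Type) (s : seq I)
    (a : I -> K) u (v : I -> V) : bilinear_for *:%R *:%R f ->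
  f u (\sum_(i <- s) a i *: v i) = \sum_(i <- s) a i *: f u (v i).
Proof.
case=> _ fr; elim: s => [|i s IHs]; last by rewrite !big_cons fr IHs.
rewrite !big_nil; have := fr u (-1) 0 0.
by rewrite /= scaler0 addr0 scaleN1r addNr.
Qed.

Lemma tens_lift_tens U V W (f : U -> V -> W) u v :
  bilinear_for *:%R *:%R f -> tens_lift f (u *t v) = f u v.
Proof.
move=> bf; rewrite {2}(coord_vbasis (memvf u)) {2}(coord_vbasis (memvf v)).
rewrite (bilinear_suml _ _ _ _ bf); apply: eq_bigr => i _.
rewrite (bilinear_sumr _ _ _ _ bf) scaler_sumr; apply: eq_bigr => j _.
by rewrite mxE scalerA.
Qed.

Lemma tens_span U V (t : tensor U V) :
  t = \sum_i \sum_j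
        (t : 'M_(_, _)) i j *: ((vbasis {:U})`_i *t (vbasis {:V})`_j).
Proof.
have freeb W : free (vbasis {:W}) := basis_free (vbasisP {:W}).
rewrite [LHS]matrix_sum_delta; apply: eq_bigr => i _; apply: eq_bigr => j _.
congr (_ *: _); apply/matrixP=> p q; rewrite !mxE !coord_free ?freeb //.
by rewrite -natrM mulnb (eq_sym i) (eq_sym j).
Qed.

End TensorTheory.

Section Poisson.
Variables (K : fieldType) (A : vectType K).
Implicit Types (br mul : A -> A -> A) (r s : tensor A A).

Record is_lie br : Prop := IsLie {
  lie_bilinear : bilinear_for *:%R *:%R br;
  lie_alternating : forall a, br a a = 0;
  lie_jacobi : forall a b c,
    br a (br b c) + br b (br c a) + br c (br a b) = 0 }.

Record is_comm_assoc mul : Prop := IsCommAssoc {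
  ca_bilinear : bilinear_for *:%R *:%R mul;
  ca_assoc : associative mul;
  ca_comm : commutative mul }.

Record is_poisson br mul : Prop := IsPoisson {
  poisson_lie : is_lie br;
  poisson_comm_assoc : is_comm_assoc mul;
  poisson_leibniz : forall a b c, br a (mul b c) = mul (br a b) c + mul b (br a c) }.

(* f (x) g on A (x) A, for linear f and g. *)
Definition tens_map (f g : A -> A) r : tensor A A :=
  tens_lift (fun a b => f a *t g b) r.

Definition flip r : tensor A A := tens_lift (fun a b => b *t a) r.

Definition sym_part r : tensor A A := 2%:R^-1 *: (r + flip r).

Definition cobracket br r (a : A) : tensor A A :=
  tens_map id (br a) r + tens_map (br a) id r.

Definition coproduct mul r (a : A) : tensor A A :=
  tens_map id (mul a) r - tens_map (mul a) id r.

(* A double sum over r = \sum_i a_i (x) b_i of an expression that is linear in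
   each of a_i, b_i, a_j and b_j, see tens_double_sum below. *)
Definition double_sum (W : vectType K) (F : A -> A -> A -> A -> W) r : W :=
  tens_lift (fun ai bi => tens_lift (fun aj bj => F ai bi aj bj) r) r.

(* The threefold tensor product is bracketed to the left. *)
Definition Cr br r : tensor (tensor A A) A :=
  double_sum (fun ai bi aj bj =>
    br ai aj *t bi *t bj + ai *t aj *t br bi bj + ai *t br bi aj *t bj) r.

Definition Ar mul r : tensor (tensor A A) A :=
  double_sum (fun ai bi aj bj =>
    mul ai aj *t bi *t bj + ai *t aj *t mul bi bj - ai *t mul aj bi *t bj) r.

Definition poisson_YBE br mul r : Prop := Cr br r = 0 /\ Ar mul r = 0.

Definition ad_L_invariant br mul s : Prop := forall a,
  tens_map (br a) id s + tens_map id (br a) s = 0 /\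
  tens_map (mul a) id s - tens_map id (mul a) s = 0.

Definition r_plus r : 'Hom('Hom(A, K^o), A) :=
  linfun (fun x : 'Hom(A, K^o) => tens_lift (fun a b => (x a : K) *: b) r).

Definition r_minus r : 'Hom('Hom(A, K^o), A) :=
  linfun (fun y : 'Hom(A, K^o) => - tens_lift (fun a b => (y b : K) *: a) r).

Definition I_r r : 'Hom('Hom(A, K^o), A) := r_plus r - r_minus r.

(* That these conditions on r make (A, br, mul, delta, Delta) a Poisson
   bialgebra is a theorem, and its axioms are therefore not repeated. *)
Record quasi_triangular br mul (delta Delta : A -> tensor A A) r : Prop :=
  QuasiTriangular {
    qt_poisson : is_poisson br mul;
    qt_delta : delta =1 cobracket br r;
    qt_Delta : Delta =1 coproduct mul r;
    qt_YBE : poisson_YBE br mul r;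
    qt_invariant : ad_L_invariant br mul (sym_part r) }.

Record factorizable br mul (delta Delta : A -> tensor A A) r : Prop :=
  Factorizable {
    factorizable_qt : quasi_triangular br mul delta Delta r;
    factorizable_bij : bijective (I_r r) }.

Record is_rota_baxter br mul (lambda : K) (P : A -> A) : Prop := IsRotaBaxter {
  rb_linear : linear P;
  rb_br : forall a b,
    br (P a) (P b) = P (br (P a) b + br a (P b) + lambda *: br a b);
  rb_mul : forall a b,
    mul (P a) (P b) = P (mul (P a) b + mul a (P b) + lambda *: mul a b) }.

Record quadratic_rota_baxter_poisson br mul (B : A -> A -> K) (P : A -> A)
    (lambda : K) : Prop := QuadraticRotaBaxterPoisson {
  qrb_poisson : is_poisson br mul;
  qrb_bilinear : bilinear_for *%R *%R B;
  qrb_nondegenerate : forall a, (forall b, B a b = 0) -> a = 0;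
  qrb_symmetric : forall a b, B a b = B b a;
  qrb_br_invariant : forall a b c, B (br a b) c = B a (br b c);
  qrb_mul_invariant : forall a b c, B (mul a b) c = B a (mul b c);
  qrb_rota_baxter : is_rota_baxter br mul lambda P;
  qrb_compat : forall a b, B a (P b) + B (P a) b + lambda * B a b = 0 }.

End Poisson.

Section PoissonTheory.
Variables (K : fieldType) (A : vectType K).
Implicit Types (r : tensor A A) (x y : 'Hom(A, K^o)).

Lemma tens_double_sum (W : vectType K) (F : A -> A -> A -> A -> W)
    n (a b : 'I_n -> A) :
  (forall u v, bilinear_for *:%R *:%R (F u v)) ->
  (forall u v, bilinear_for *:%R *:%R (fun a b => F a b u v)) ->
  double_sum F (\sum_i a i *t b i) = \sum_i \sum_j F (a i) (b i) (a j) (b j).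
Proof.
move=> bF1 bF2; rewrite /double_sum linear_sum; apply: eq_bigr => i _ /=.
rewrite tens_lift_tens; last first.
  have E (G1 G2 G3 : A -> A -> W) (c : K) t :
      (forall u v, G1 u v = c *: G2 u v + G3 u v) ->
      tens_lift G1 t = c *: tens_lift G2 t + tens_lift G3 t.
    move=> EG; rewrite /tens_lift scaler_sumr -big_split /=; apply: eq_bigr => k _.
    rewrite scaler_sumr -big_split /=; apply: eq_bigr => l _.
    by rewrite EG scalerDr !scalerA mulrC.
  split=> [v c u u' | u c v v']; apply: E => p q.
  - exact: (bF2 p q).1.
  - exact: (bF2 p q).2.
by rewrite linear_sum; apply: eq_bigr => j _ /=; rewrite tens_lift_tens.
Qed.

Let sum3 (W : lmodType K) c (x1 x2 x3 y1 y2 y3 : W) :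
  (c *: x1 + y1) + (c *: x2 + y2) + (c *: x3 + y3) =
  c *: (x1 + x2 + x3) + (y1 + y2 + y3).
Proof. by rewrite !scalerDr [X in X + _ = _]addrACA [LHS]addrACA. Qed.

Lemma Cr_sum br n (a b : 'I_n -> A) : bilinear_for *:%R *:%R br ->
  Cr br (\sum_i a i *t b i) = \sum_i \sum_j
    (br (a i) (a j) *t b i *t b j + a i *t a j *t br (b i) (b j)
     + a i *t br (b i) (a j) *t b j).
Proof.
move=> [linl linr].
have L c u u' v : br (c *: u + u') v = c *: br u v + br u' v by exact: linl.
have R c u v v' : br u (c *: v + v') = c *: br u v + br u v' by exact: linr.
have tl (U V : vectType K) c (u u' : U) (v : V) :
  (c *: u + u') *t v = c *: (u *t v) + u' *t v by exact: (tens_bilinear U V).1.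
have tr (U V : vectType K) c (u : U) (v v' : V) :
  u *t (c *: v + v') = c *: (u *t v) + u *t v' by exact: (tens_bilinear U V).2.
rewrite /Cr tens_double_sum // => u v.
- by split=> w c x y /=; rewrite !(L, R, tl, tr) sum3.
- by split=> w c x y /=; rewrite !(L, R, tl, tr) sum3.
Qed.

Lemma Ar_sum mul n (a b : 'I_n -> A) : bilinear_for *:%R *:%R mul ->
  Ar mul (\sum_i a i *t b i) = \sum_i \sum_j
    (mul (a i) (a j) *t b i *t b j + a i *t a j *t mul (b i) (b j)
     - a i *t mul (a j) (b i) *t b j).
Proof.
move=> [linl linr].
have L c u u' v : mul (c *: u + u') v = c *: mul u v + mul u' v by exact: linl.
have R c u v v' : mul u (c *: v + v') = c *: mul u v + mul u v' by exact: linr.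
have tl (U V : vectType K) c (u u' : U) (v : V) :
  (c *: u + u') *t v = c *: (u *t v) + u' *t v by exact: (tens_bilinear U V).1.
have tr (U V : vectType K) c (u : U) (v v' : V) :
  u *t (c *: v + v') = c *: (u *t v) + u *t v' by exact: (tens_bilinear U V).2.
rewrite /Ar tens_double_sum // => u v.
- by split=> w c x y /=; rewrite !(L, R, tl, tr) opprD -!scalerN sum3.
- by split=> w c x y /=; rewrite !(L, R, tl, tr) opprD -!scalerN sum3.
Qed.

Definition tens_pairing r x y : K :=
  tens_lift (fun a b => x a * y b : K^o) r.

Lemma r_plus_pairing r x y : y (r_plus r x) = tens_pairing r x y.
Proof.
pose f (x : 'Hom(A, K^o)) := tens_lift (fun a b => (x a : K) *: b) r.
have lin : linear f.
  move=> c u v; rewrite /f /tens_lift scaler_sumr -big_split /=; apply: eq_bigr => k _.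
  rewrite scaler_sumr -big_split /=; apply: eq_bigr => l _.
  by rewrite add_lfunE scale_lfunE scalerDl scalerDr !scalerA mulrCA mulrA.
pose F : {linear 'Hom(A, K^o) -> A} :=
  HB.pack f (GRing.isLinear.Build K 'Hom(A, K^o) A *:%R f lin).
rewrite /r_plus (lfunE F) /= /tens_pairing /tens_lift linear_sum.
apply: eq_bigr => i _ /=; rewrite linear_sum; apply: eq_bigr => j _ /=.
by rewrite linearZ /= linearZ.
Qed.

Lemma r_minus_pairing r x y : - x (r_minus r y) = tens_pairing r x y.
Proof.
pose f (y : 'Hom(A, K^o)) := - tens_lift (fun a b => (y b : K) *: a) r.
have lin : linear f.
  move=> c u v; rewrite /f scalerN -opprD; congr (- _).
  rewrite /tens_lift scaler_sumr -big_split /=; apply: eq_bigr => k _.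
  rewrite scaler_sumr -big_split /=; apply: eq_bigr => l _.
  by rewrite add_lfunE scale_lfunE scalerDl scalerDr !scalerA mulrCA mulrA.
pose F : {linear 'Hom(A, K^o) -> A} :=
  HB.pack f (GRing.isLinear.Build K 'Hom(A, K^o) A *:%R f lin).
rewrite /r_minus (lfunE F) /= linearN opprK /tens_pairing /tens_lift linear_sum.
apply: eq_bigr => i _ /=; rewrite linear_sum; apply: eq_bigr => j _ /=.
rewrite linearZ /= linearZ /=; congr (_ * _); exact: mulrC.
Qed.

End PoissonTheory.

(* Main.v *)
(* Put I = I_r and let a multiplication act on A^* by (a.x)(b) = x(ab).
   Invariance of the symmetric part of r says I(a.x) = -[a, I x] for the bracket
   and I(a.x) = a * I x for the product.  Paired with x (x) y (x) z, the equation
   C(r) = 0 reads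
     x[r_- y, r_- z] + z[r_+ x, r_+ y] - y[r_+ x, r_- z] = 0,
   and since z(r_+ w) = - w(r_- z) it becomes
     [r_+ x, r_+ y] = r_+ (- (r_+ x).y + (r_- y).x);
   by invariance, I maps the argument of r_+ here to
     [r_+ x, I y] + [I x, r_+ y] - [I x, I y],
   which is the Rota-Baxter identity at a = I x, b = I y.  The product is the
   same up to a sign. *)
Require Import Defs.
From HB Require Import structures.
From mathcomp Require Import all_boot all_order all_algebra.
From mathcomp Require Import ring.

Set Implicit Arguments.
Unset Strict Implicit.
Unset Printing Implicit Defensive.

Import GRing.Theory.
Local Open Scope ring_scope.

(** * Functionals on tensor powers and the maps [r_plus], [r_minus] and [I_r] *)

Section Pairing.
Variables (K : fieldType) (A : vectType K).
Implicit Types (r s : tensor A A) (x y z : 'Hom(A, K^o)).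

Lemma dual_separates (a b : A) :
  (forall x : 'Hom(A, K^o), x a = x b) -> a = b.
Proof.
move=> eq_ab; rewrite (coord_vbasis (memvf a)) (coord_vbasis (memvf b)).
apply: eq_bigr => i _; congr (_ *: _).
have lin : linear (coord (vbasis {:A}) i : A -> K^o) by move=> c u v; rewrite linearP.
pose F : {linear A -> K^o} := HB.pack (coord (vbasis {:A}) i : A -> K^o)
  (GRing.isLinear.Build K A K^o *:%R _ lin).
by have := eq_ab (linfun F); rewrite !lfunE.
Qed.

(** Collecting the matrix coefficients by column moves them into the first factors. An arbitrary [r]
    thus takes the form required by [Cr_sum] and [Ar_sum]. *)
Lemma tensor_sum r : exists n (a b : 'I_n -> A), r = \sum_i a i *t b i.
Proof.
exists (\dim {:A}), (fun j => \sum_i (r : 'M_(_, _)) i j *: (vbasis {:A})`_i),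
  (fun j => (vbasis {:A})`_j).
rewrite {1}[r]tens_span exchange_big /=; apply: eq_bigr => j _.
by rewrite (bilinear_suml _ _ _ _ (tens_bilinear A A)).
Qed.

Lemma pairing_bilinear x y :
  bilinear_for *:%R *:%R (fun a b => x a * y b : K^o).
Proof.
split=> [b c u v | a c u v] /=; rewrite linearP /= /GRing.scale /=.
  by rewrite mulrDl mulrA.
by rewrite mulrDr mulrCA.
Qed.

(* This is tens_pairing, with the tensor last and values in K^o so that it
   carries an instance of {linear _ -> _}. *)
Definition dual_tens2 x y (t : tensor A A) : K^o :=
  tens_lift (fun a b => x a * y b : K^o) t.

Lemma dual_tens2_linear x y : linear (dual_tens2 x y).
Proof. by move=> c u v; rewrite /dual_tens2 linearP. Qed.

HB.instance Definition _ x y := GRing.isLinear.Build K (tensor A A) K^o *:%R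
  (dual_tens2 x y) (dual_tens2_linear x y).

Lemma dual_tens2_tens a b x y : dual_tens2 x y (a *t b) = x a * y b.
Proof. by rewrite /dual_tens2 tens_lift_tens //; apply: pairing_bilinear. Qed.

Lemma dual_tens2_sum n (a b : 'I_n -> A) x y :
  dual_tens2 x y (\sum_i a i *t b i) = \sum_i x (a i) * y (b i).
Proof.
by rewrite linear_sum; apply: eq_bigr => i _; apply: dual_tens2_tens.
Qed.

Definition dual_tens3 x y z (t : tensor (tensor A A) A) : K^o :=
  tens_lift (fun u c => dual_tens2 x y u * z c : K^o) t.

Lemma dual_tens3_linear x y z : linear (dual_tens3 x y z).
Proof. by move=> c u v; rewrite /dual_tens3 linearP. Qed.

HB.instance Definition _ x y z :=
  GRing.isLinear.Build K (tensor (tensor A A) A) K^o *:%R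
    (dual_tens3 x y z) (dual_tens3_linear x y z).

Lemma dual_tens3_tens a b c x y z :
  dual_tens3 x y z (a *t b *t c) = x a * y b * z c.
Proof.
rewrite /dual_tens3 tens_lift_tens ?dual_tens2_tens //.
split=> [w k u v | u k v w] /=.
  by rewrite linearP /= /GRing.scale /= mulrDl mulrA.
by rewrite linearP /= /GRing.scale /= mulrDr mulrCA.
Qed.

Lemma r_plus_dual r x y : y (r_plus r x) = dual_tens2 x y r.
Proof. exact: r_plus_pairing. Qed.

Lemma r_minus_dual r x y : - x (r_minus r y) = dual_tens2 x y r.
Proof. exact: r_minus_pairing. Qed.

Lemma r_plus_sum n (a b : 'I_n -> A) x :
  r_plus (\sum_i a i *t b i) x = \sum_i x (a i) *: b i.
Proof.
apply: dual_separates => y; rewrite r_plus_dual dual_tens2_sum linear_sum.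
by apply: eq_bigr => i _; rewrite linearZ.
Qed.

Lemma r_minus_sum n (a b : 'I_n -> A) y :
  r_minus (\sum_i a i *t b i) y = \sum_i - y (b i) *: a i.
Proof.
apply: dual_separates => x; apply: oppr_inj.
rewrite r_minus_dual dual_tens2_sum linear_sum -sumrN.
by apply: eq_bigr => i _; rewrite linearZ /= [_ *: _]mulNr opprK mulrC.
Qed.

Lemma r_plus_minus r x y : y (r_plus r x) = - x (r_minus r y).
Proof. by rewrite r_plus_dual r_minus_dual. Qed.

Lemma I_rE r x : I_r r x = r_plus r x - r_minus r x.
Proof. by rewrite /I_r add_lfunE opp_lfunE. Qed.

Lemma I_r_sym r x y : y (I_r r x) = x (I_r r y).
Proof. by rewrite !I_rE !linearB /= !r_plus_minus addrC. Qed.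

Lemma dual_tens2_map (f g : A -> A) r x y x' y' :
    x' =1 x \o f -> y' =1 y \o g ->
  dual_tens2 x y (tens_map f g r) = dual_tens2 x' y' r.
Proof.
move=> Ex Ey; rewrite /tens_map {1}/tens_lift linear_sum /=.
apply: eq_bigr => i _; rewrite linear_sum /=.
apply: eq_bigr => j _; rewrite linearZ /=.
by rewrite dual_tens2_tens Ex Ey.
Qed.

Lemma dual_tens2_flip r x y : dual_tens2 x y (flip r) = dual_tens2 y x r.
Proof.
rewrite /flip {1}/tens_lift linear_sum /=.
apply: eq_bigr => i _; rewrite linear_sum /=.
apply: eq_bigr => j _; rewrite linearZ /=.
by rewrite dual_tens2_tens mulrC.
Qed.

(** Since [r_minus] is minus the transpose of [r_plus], [I_r] is twice the symmetric part, read as a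
    map out of the dual. *)
Lemma dual_tens2_sym_part r x y :
  dual_tens2 x y (sym_part r) = 2%:R^-1 * y (I_r r x).
Proof.
rewrite /sym_part linearZ linearD /= dual_tens2_flip.
by rewrite I_rE linearB /= r_plus_dual r_minus_dual.
Qed.

(** * Transposed multiplications, invariance and the two Yang-Baxter equations *)

Section Multiplication.
Variable m : A -> A -> A.
Hypothesis bilin_m : bilinear_for *:%R *:%R m.

(** The transpose of [m a], without the sign of the coadjoint action. *)
Definition dual_mul (a : A) x : 'Hom(A, K^o) := (x \o linfun (m a))%VF.

Lemma dual_mulE a x b : dual_mul a x b = x (m a b).
Proof.
pose F : {linear A -> A} :=
  HB.pack (m a) (GRing.isLinear.Build K A A *:%R _ (bilin_m.2 a)).
by rewrite /dual_mul comp_lfunE (lfunE F).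
Qed.

Lemma dual_tens2_mull a r x y :
  dual_tens2 x y (tens_map (m a) id r) = dual_tens2 (dual_mul a x) y r.
Proof. by apply: dual_tens2_map => // b; rewrite dual_mulE. Qed.

Lemma dual_tens2_mulr a r x y :
  dual_tens2 x y (tens_map id (m a) r) = dual_tens2 x (dual_mul a y) r.
Proof. by apply: dual_tens2_map => // b; rewrite dual_mulE. Qed.

(** Pairing the invariance with [x] and [y] moves [m a] onto the functionals, and the common factor
    1/2 cancels. Here [e] is 1 for the bracket and -1 for the product. *)
Lemma I_r_invariant (e : K) a r : 2%:R != 0 :> K ->
    tens_map (m a) id (sym_part r) + e *: tens_map id (m a) (sym_part r) = 0 ->
  forall x, I_r r (dual_mul a x) = - e *: m a (I_r r x).
Proof.
move=> nz2 inv x; apply: dual_separates => y.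
have := congr1 (dual_tens2 x y) inv.
rewrite linearD linearZ linear0 /= dual_tens2_mull dual_tens2_mulr.
rewrite !dual_tens2_sym_part dual_mulE [y (- e *: _)]linearZ.
rewrite /GRing.scale /= [e * _]mulrCA -mulrDr => /eqP.
by rewrite mulf_eq0 invr_eq0 (negPf nz2) /= addr_eq0 => /eqP ->; rewrite scaleNr.
Qed.

Lemma dual_bilinear_sum n (c d : 'I_n -> K) (a b : 'I_n -> A) x :
  x (m (\sum_i c i *: a i) (\sum_j d j *: b j)) =
  \sum_i \sum_j c i * d j * x (m (a i) (b j)).
Proof.
rewrite (bilinear_suml _ _ _ _ bilin_m) linear_sum; apply: eq_bigr => i _ /=.
rewrite (bilinear_sumr _ _ _ _ bilin_m) scaler_sumr linear_sum.
by apply: eq_bigr => j _; rewrite scalerA linearZ.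
Qed.
(** Contracting the [a i] with a functional gives [r_plus], contracting the [b i] gives minus
    [r_minus]: two signs cancel in the first term, one survives in the last. *)
Lemma dual_Cr r x y z :
  dual_tens3 x y z (Cr m r) =
    x (m (r_minus r y) (r_minus r z)) + z (m (r_plus r x) (r_plus r y))
    - y (m (r_plus r x) (r_minus r z)).
Proof.
have [n [a [b ->]]] := tensor_sum r.
rewrite Cr_sum // linear_sum !r_minus_sum !r_plus_sum !dual_bilinear_sum.
rewrite -sumrN -!big_split /=; apply: eq_bigr => i _.
rewrite linear_sum -sumrN -!big_split /=; apply: eq_bigr => j _.
by rewrite !linearD /= !dual_tens3_tens; ring.
Qed.

(** Commutativity reorders [m (a j) (b i)] in the last term, whose minus sign cancels that of
    [r_minus]. *)
Lemma dual_Ar r x y z : commutative m ->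
  dual_tens3 x y z (Ar m r) =
    x (m (r_minus r y) (r_minus r z)) + z (m (r_plus r x) (r_plus r y))
    + y (m (r_plus r x) (r_minus r z)).
Proof.
move=> mC; have [n [a [b ->]]] := tensor_sum r.
rewrite Ar_sum // linear_sum !r_minus_sum !r_plus_sum !dual_bilinear_sum.
rewrite -!big_split /=; apply: eq_bigr => i _.
rewrite linear_sum -!big_split /=; apply: eq_bigr => j _.
by rewrite linearB linearD /= !dual_tens3_tens (mC (a j)); ring.
Qed.

(** * The Rota-Baxter identity for both operations at once *)

Section RotaBaxter.
(* The case e = 1 is the bracket, and e = -1 the commutative product. *)
Variables (e : K) (r : tensor A A).
Hypothesis m_skew : forall a b, m a b = - e *: m b a.
Hypothesis I_r_dual : forall a x, I_r r (dual_mul a x) = - e *: m a (I_r r x).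
Hypothesis ybe : forall x y z,
  x (m (r_minus r y) (r_minus r z)) + z (m (r_plus r x) (r_plus r y))
  - e * y (m (r_plus r x) (r_minus r z)) = 0.

Lemma mul_r_plus x y :
  m (r_plus r x) (r_plus r y) =
  r_plus r (- e *: dual_mul (r_plus r x) y + dual_mul (r_minus r y) x).
Proof.
apply: dual_separates => z; have /eqP := ybe x y z.
rewrite r_plus_minus add_lfunE scale_lfunE !dual_mulE /GRing.scale /=.
rewrite addrAC addrC addr_eq0 => /eqP ->.
by rewrite [X in _ = - X]addrC mulNr.
Qed.

Lemma I_r_mul_r_plus x y :
  I_r r (- e *: dual_mul (r_plus r x) y + dual_mul (r_minus r y) x) =
  m (r_plus r x) (I_r r y) + m (I_r r x) (r_plus r y) - m (I_r r x) (I_r r y).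
Proof.
have mB a b c : m a (b - c) = m a b - m a c.
  by have := bilin_m.2 a (- 1) c b; rewrite /= !scaleN1r ![- _ + _]addrC.
(* Using [m_skew] twice absorbs the square of [- e] in the first term; using it once swaps the
   factors of the second. *)
rewrite linearD linearZ /= !I_r_dual -!m_skew.
rewrite -addrA -mB; congr (_ + m _ _).
by rewrite I_rE opprB addrC subrK.
Qed.

(** At [a = I_r r x], [b = I_r r y] the argument of the outer [P] is [- lambda] times the left side
    of [I_r_mul_r_plus], so both sides are [lambda ^ 2] times those of [mul_r_plus]. *)
Lemma r_plus_rota_baxter (lambda : K) a b (P : A -> A) : bijective (I_r r) ->
    P =1 (fun c => - lambda *: r_plus r ((I_r r)^-1%VF c)) ->
  m (P a) (P b) = P (m (P a) b + m a (P b) + lambda *: m a b).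
Proof.
move=> bijI EP; have IK : cancel (I_r r) (I_r r)^-1%VF.
  by apply: lker0_lfunK; apply/lker0P; exact: bij_inj.
have [J _ JK] := bijI; rewrite -(JK a) -(JK b) !EP !IK.
move: (J a) (J b) => x y.
have mZl k u v : m (k *: u) v = k *: m u v.
  by have := bilinear_suml [:: tt] (fun=> k) (fun=> u) v bilin_m; rewrite !big_seq1.
have mZr k u v : m u (k *: v) = k *: m u v.
  by have := bilinear_sumr [:: tt] (fun=> k) u (fun=> v) bilin_m; rewrite !big_seq1.
rewrite !mZl !mZr scalerA.
have -> : - lambda *: m (r_plus r x) (I_r r y) + - lambda *: m (I_r r x) (r_plus r y)
    + lambda *: m (I_r r x) (I_r r y) =
    - lambda *: (I_r r (- e *: dual_mul (r_plus r x) y + dual_mul (r_minus r y) x)).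
  by rewrite I_r_mul_r_plus scalerBr scalerDr !scaleNr opprK.
by rewrite !linearZ /= IK -mul_r_plus scalerA.
Qed.
End RotaBaxter.
End Multiplication.
End Pairing.

(** * The quadratic Rota-Baxter structure of a factorizable bialgebra *)

Theorem theorem4p7 (K : fieldType) (charK : [pchar K] =i pred0)
    (A : vectType K) (br mul : A -> A -> A)
    (delta Delta : A -> tensor A A) (r : tensor A A)
    (hfact : factorizable br mul delta Delta r)
    (lambda : K) (hlambda : lambda != 0) :
  quadratic_rota_baxter_poisson br mul
    (fun a b : A => - lambda * ((I_r r)^-1%VF a : 'Hom(A, K^o)) b)
    (- lambda *: (r_plus r \o (I_r r)^-1)%VF : 'End(A))
    lambda.
Proof.
have nz2 : 2%:R != 0 :> K by rewrite ((pcharf0P K).1 charK).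
have [[poisA _ _ [YC YA] inv] bijI] := hfact.
have [lieA caA _] := poisA; have [bilB alt _] := lieA; have [bilM _ mulC] := caA.
have IK : cancel (I_r r) (I_r r)^-1%VF.
  by apply: lker0_lfunK; apply/lker0P; exact: bij_inj.
have [J _ JK] := bijI.
have skew a b : br a b = - br b a.
  have brDl u v w : br (u + v) w = br u w + br v w.
    by have := bilB.1 w 1 u v; rewrite /= !scale1r.
  have brDr u v w : br w (u + v) = br w u + br w v.
    by have := bilB.2 w 1 u v; rewrite /= !scale1r.
  apply/eqP; rewrite -addr_eq0; have := alt (a + b).
  by rewrite brDl !brDr !alt add0r addr0 => ->.
have dualB a x : I_r r (dual_mul br a x) = - 1 *: br a (I_r r x).
  by apply: (I_r_invariant bilB nz2); rewrite scale1r; have [] := inv a.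
have dualM a x : I_r r (dual_mul mul a x) = - (- 1) *: mul a (I_r r x).
  by apply: (I_r_invariant bilM nz2); rewrite scaleN1r; have [] := inv a.
have PE : (- lambda *: (r_plus r \o (I_r r)^-1)%VF : 'End(A)) =1
    (fun c => - lambda *: r_plus r ((I_r r)^-1%VF c)).
  by move=> c; rewrite scale_lfunE comp_lfunE.
split=> //.
- split=> [b k u v | a k u v] /=.
    by rewrite linearP add_lfunE scale_lfunE mulrDr; congr (_ + _); exact: mulrCA.
  by rewrite linearP mulrDr; congr (_ + _); exact: mulrCA.
- move=> a B0; rewrite -(JK a); have -> : J a = 0; last exact: linear0.
  apply/lfunP=> b; rewrite zero_lfunE.
  have /eqP := B0 b; rewrite -{1}(JK a) IK mulf_eq0 oppr_eq0 (negPf hlambda).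
  by move/eqP.
- by move=> a b; rewrite -(JK a) -(JK b) !IK I_r_sym.
(* By invariance [br a b] is the image under [I_r r] of [dual_mul br b (J a)], so both sides are
   [- lambda * J a (br b c)]. *)
- move=> a b c; rewrite -(JK a) skew.
  have -> : - br b (I_r r (J a)) = I_r r (dual_mul br b (J a)).
    by rewrite dualB scaleN1r.
  by rewrite !IK dual_mulE.
- move=> a b c; rewrite -(JK a) mulC.
  have -> : mul b (I_r r (J a)) = I_r r (dual_mul mul b (J a)).
    by rewrite dualM opprK scale1r.
  by rewrite !IK dual_mulE.
- split=> [|a b|a b]; first exact: linearP.
  + apply: (@r_plus_rota_baxter _ _ br bilB 1 r _ _ _ lambda a b _ bijI PE) => // [u v|x y z].
      by rewrite scaleN1r.
    by rewrite mul1r -dual_Cr // YC linear0.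
  + apply: (@r_plus_rota_baxter _ _ mul bilM (- 1) r _ _ _ lambda a b _ bijI PE) => // [u v|x y z].
      by rewrite opprK scale1r.
    by rewrite mulN1r opprK -dual_Ar // YA linear0.
- move=> a b; rewrite -(JK a) -(JK b) !PE !IK.
  move: (J a) (J b) => x y.
  have IVK c : I_r r ((I_r r)^-1%VF c) = c by rewrite -{1}(JK c) IK JK.
  (* Symmetry of [I_r] removes the inverse; the sum becomes [lambda ^ 2] times [x (r_plus r y) - x
     (r_minus r y) - x (I_r r y)]. *)
  rewrite [_ (I_r r y)]I_r_sym IVK I_rE linearB !linearZ /= (r_plus_minus r x y).
  by rewrite /GRing.scale /=; ring.
Qed.
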